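(* Let $A \in \mathbb{R}_{\le (r_1',\dots,r_{d-1}')}^{n_1\times\cdots\times n_d}$ and let $(r_1,\dots,r_{d-1})$ be positive integers with $r_i\le r_i'$ for $i=1,\dots,d-1$. The TT-rounding algorithm (described in the context), viewed as a set-valued map sending $A$ to the set of its possible outputs with target rank $(r_1,\dots,r_{d-1})$, is an approximate projection $$\tilde{\mathcal P}:\ \mathbb{R}_{\le (r_1',\dots,r_{d-1}')}^{n_1\times\cdots\times n_d}\ \multimap\ \mathbb{R}_{\le (r_1,\dots,r_{d-1})}^{n_1\times\cdots\times n_d}$$ in the following sense: every output $X\in\tilde{\mathcal P}(A)$ satisfies $$\langle A - X, X\rangle = 0,\qquad\text{equivalently}\qquad \langle A,X\rangle=\|X\|^2,$$ and thus satisfies the angle condition $$\|X\|\ \ge\ \omega\,\Big\|\mathcal P_{\mathbb{R}_{\le (r_1,\dots,r_{d-1})}^{n_1\times\cdots\times n_d}}A\Big\|,\qquad \omega=\sqrt{\frac{\prod_{i=2}^{d-1} r_i}{\prod_{i=2}^{d-1} r_i'}} .$$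
   Context: Tensors and reshaping. $\langle X,Y\rangle=\langle \mathrm{vec}(X),\mathrm{vec}(Y)\rangle$ is the Euclidean inner product on $\mathbb{R}^{n_1\times\cdots\times n_d}$ and $\|\cdot\|$ the induced norm. All reshapings are column-major (first index runs fastest). For a tensor $X$, the right unfolding $X^{\mathrm R}$ is the matrix whose column index is the last index of $X$ (all other indices merged into the row index), and the left unfolding $X^{\mathrm L}$ is the matrix whose row index is the first index of $X$ (all others merged into the column index). The symbol ''$\cdot$'' between two tensors (or a matrix and a tensor) denotes contraction of the last index of the first factor with the first index of the second. TT-rank. A tensor-train decomposition of $X\in\mathbb{R}^{n_1\times\cdots\times n_d}$ is $X=X_1\cdot X_2\cdots X_d$ with $X_i\in\mathbb{R}^{r_{i-1}\times n_i\times r_i}$, $r_0=r_d=1$ (so the first and last factors are treated as matrices in $\mathbb{R}^{n_1\times r_1}$ and $\mathbb{R}^{r_{d-1}\times n_d}$). The TT-rank of $X$ is $(\operatorname{rank}X^{<1>},\dots,\operatorname{rank}X^{<d-1>})$, where $X^{<i>}$ is the $n_1\cdots n_i\times n_{i+1}\cdots n_d$ reshaping of $X$. $\mathbb{R}_{\le (k_1,\dots,k_{d-1})}^{n_1\times\cdots\times n_d}$ is the set of tensors of TT-rank at most $(k_1,\dots,k_{d-1})$, elementwise. Stiefel manifold: $\mathrm{St}(p,n)=\{U\in\mathbb{R}^{n\times p}: U^\top U=I_p\}$. Exact projection: $\mathcal P_{\mathbb{R}_{\le (r_1,\dots,r_{d-1})}^{n_1\times\cdots\times n_d}}A$ is the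 set of minimizers of $\|A-X\|^2$ over $X\in \mathbb{R}_{\le (r_1,\dots,r_{d-1})}^{n_1\times\cdots\times n_d}$. Since this set is a closed cone, all elements of the projection have the same norm, and this common value is denoted $\big\|\mathcal P_{\mathbb{R}_{\le (r_1,\dots,r_{d-1})}^{n_1\times\cdots\times n_d}}A\big\|$. Truncated SVD: $[U,S,V]=\mathrm{SVD}_s(B)$ means that $S$ is the $s\times s$ diagonal matrix of the $s$ largest singular values of $B$ and $U,V$ have as columns corresponding orthonormal left and right singular vectors (any choice allowed); $USV^\top$ is then a best rank-at-most-$s$ approximation of $B$. If $s$ exceeds the number of singular values of $B$, the thin SVD is used, padded by zeros. TT-rounding algorithm. Input: $A=\dot A_1\cdot A_2''\cdots A_d''$ with $\dot A_1\in\mathbb{R}^{n_1\times r_1'}$, $A_i''\in\mathbb{R}^{r_{i-1}'\times n_i\times r_i'}$ for $i=2,\dots,d$ ($r_d'=1$) and $\left((A_i'')^{\mathrm L}\right)^\top\in\mathrm{St}(r_{i-1}',n_ir_i')$ for $i=2,\dots,d$; and target ranks $r_1,\dots,r_{d-1}$. For $i=1,\dots,d-1$: compute $[(X_i')^{\mathrm R},S_i,V_i]=\mathrm{SVD}_{r_i}(\dot A_i^{\mathrm R})$ and set $\dot A_{i+1}:=S_iV_i^\top\cdot A_{i+1}''$. Finally set $\dot X_d:=\dot A_d$. Output: $X=X_1'\cdots X_{d-1}'\cdot\dot X_d$. *)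

(* Defs.v *)
From HB Require Import structures.
From mathcomp Require Import all_boot all_order all_algebra.
From mathcomp Require Import classical_sets reals.

Set Implicit Arguments.
Unset Strict Implicit.
Unset Printing Implicit Defensive.

Import Order.TTheory GRing.Theory Num.Theory.

Local Open Scope classical_set_scope.
Local Open Scope ring_scope.

(* Modes are numbered from 0: a tensor of order D has sizes n 0, ..., n D.-1.
   The bond rank r i, 0 < i < D, separates the modes j < i from the modes
   j >= i.  The values of n and r outside these ranges are irrelevant.

   A tensor X is represented by the row vector vec(X), in column-major order
   (first mode fastest).  Since [mxvec] is row-major, [mxvec_index x a] merges
   the pair of indices (a, x) with a fastest.                                 *)

Lemma mxvec_index_val (m n : nat) (i : 'I_m) (j : 'I_n) :
  mxvec_index i j = (i * n + j)%N :> nat.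
Proof.
have index_pairs (s : seq 'I_m) : i \in s ->
    index (i, j) [seq (x, y) | x <- s, y <- enum 'I_n] = (index i s * n + j)%N.
  elim: s => //= x s IHs; rewrite inE index_cat eq_sym => /orP.
  have [-> _|neq_xi] := eqVneq x i.
    rewrite map_f ?mem_enum // index_map; last by move=> ? ? [].
    by rewrite index_enum_ord.
  case=> // /IHs ->; rewrite size_map size_enum_ord mulSn addnA.
  by case: ifP => // /mapP[y _ [/esym /eqP]]; rewrite (negPf neq_xi).
rewrite /mxvec_index /= -[in RHS](index_enum_ord i) -index_pairs ?mem_enum //.
rewrite /enum_rank [enum_rank_in]unlock insubdK /=; last first.
  by rewrite unfold_in cardE index_mem mem_enum.
by rewrite enumT [in LHS]unlock.
Qed.

Fixpoint numel (n : nat -> nat) (k : nat) : nat :=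
  if k is j.+1 then (n j * numel n j)%N else 1%N.

Definition tensor (R : realType) (n : nat -> nat) (D : nat) : Type :=
  'rV[R]_(numel n D).

Definition dot (R : realType) (k : nat) (X Y : 'rV[R]_k) : R :=
  \sum_j X 0 j * Y 0 j.

Definition enorm (R : realType) (k : nat) (X : 'rV[R]_k) : R :=
  Num.sqrt (dot X X).

Lemma numel_split (n : nat -> nat) (D : nat) (i : 'I_D) :
  numel n D = (\prod_(i <= j < D) n j * numel n i)%N.
Proof.
case: i => i /= /ltnW; elim: D => [|D IHD].
  by rewrite leqn0 => /eqP->; rewrite big_geq.
rewrite leq_eqVlt ltnS => /orP[/eqP->|leiD]; first by rewrite big_geq ?mul1n.
by rewrite big_nat_recr //= IHD // mulnA (mulnC (n D)).
Qed.

(* X^{<i>}: its rows are indexed by the modes j < i, its columns by the others. *)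
Definition unfolding (R : realType) (n : nat -> nat) (D : nat)
    (X : tensor R n D) (i : 'I_D) :
    'M[R]_(numel n i, \prod_(i <= j < D) n j) :=
  (vec_mx (castmx (erefl 1%N, numel_split n i) X))^T.

Definition tt_le (R : realType) (n : nat -> nat) (D : nat) (k : nat -> nat) :
    set (tensor R n D) :=
  [set X | forall i : 'I_D, (0 < i)%N -> (\rank (unfolding X i) <= k i)%N].

Definition tt_proj (R : realType) (n : nat -> nat) (D : nat) (k : nat -> nat)
    (A : tensor R n D) : set (tensor R n D) :=
  [set Y | tt_le k Y /\
           forall Z : tensor R n D, tt_le k Z ->
             enorm (A - Y) ^+ 2 <= enorm (A - Z) ^+ 2].

Definition stiefel (R : realType) (p m : nat) (U : 'M[R]_(m, p)) : Prop :=
  U^T *m U = 1%:M.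

(* The entry (a, x, b) of C is [C x a b]. *)
Definition tensor3 (R : realType) (a m b : nat) : Type := 'I_m -> 'M[R]_(a, b).

Definition runfold (R : realType) (a m b : nat) (C : tensor3 R a m b) :
    'M[R]_(m * a, b) :=
  (\matrix_(j < b) mxvec (\matrix_(x < m, i < a) C x i j))^T.

Definition lunfold (R : realType) (a m b : nat) (C : tensor3 R a m b) :
    'M[R]_(a, b * m) :=
  \matrix_(i < a) mxvec (\matrix_(j < b, x < m) C x i j).

Definition bond (r : nat -> nat) (i : nat) : nat := if i is 0 then 1%N else r i.

(* The first d factors of a decomposition of a tensor of order d.+1; the last
   factor is a matrix of size bond r d x n d. *)
Definition tt_cores (R : realType) (n r : nat -> nat) : Type :=
  forall i : nat, tensor3 R (bond r i) (n i) (bond r i.+1).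

(* C 0 . C 1 ... C k.-1, with the k modes merged into the row index. *)
Fixpoint tt_left (R : realType) (n r : nat -> nat) (C : tt_cores R n r)
    (k : nat) : 'M[R]_(numel n k, bond r k) :=
  if k is j.+1 then runfold (fun x => tt_left C j *m C j x) else 1%:M.

Definition tt_prod (R : realType) (n r : nat -> nat) (d : nat)
    (C : tt_cores R n r) (L : 'M[R]_(bond r d, n d)) : tensor R n d.+1 :=
  mxvec (tt_left C d *m L)^T.

Definition thin_svd (R : realType) (m p : nat) (B : 'M[R]_(m, p))
    (U : 'M[R]_(m, minn m p)) (sigma : 'rV[R]_(minn m p))
    (V : 'M[R]_(p, minn m p)) : Prop :=
  [/\ stiefel U, stiefel V,
      forall i, 0 <= sigma 0 i,
      forall i j : 'I_(minn m p), (i <= j)%N -> sigma 0 j <= sigma 0 i &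
      B = U *m diag_mx sigma *m V^T].

(* Right multiplication by [pid_mx q : 'M_(q, s)] keeps the first s columns, and
   pads with zero columns when q < s. *)
Definition trunc_svd (R : realType) (m p s : nat) (B : 'M[R]_(m, p))
    (U : 'M[R]_(m, s)) (S : 'M[R]_s) (V : 'M[R]_(p, s)) : Prop :=
  let q := minn m p in
  exists U0 sigma V0,
    [/\ thin_svd B U0 sigma V0,
        U = U0 *m (pid_mx q : 'M_(q, s)),
        S = (pid_mx q : 'M_(s, q)) *m diag_mx sigma *m (pid_mx q : 'M_(q, s)) &
        V = V0 *m (pid_mx q : 'M_(q, s))].

(* The factor S_i V_i^T contracted into the next core; it is 1 for the first
   core, which enters the algorithm unchanged. *)
Definition carry (R : realType) (r r' : nat -> nat)
    (S : forall i, 'M[R]_(bond r i.+1))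
    (V : forall i, 'M[R]_(bond r' i.+1, bond r i.+1)) (i : nat) :
    'M[R]_(bond r i, bond r' i) :=
  if i is j.+1 then S j *m (V j)^T else 1%:M.

Definition tt_rounding (R : realType) (n : nat -> nat) (d : nat)
    (r' r : nat -> nat) (A : tensor R n d.+1) : set (tensor R n d.+1) :=
  [set X |
    exists (C : tt_cores R n r') (L : 'M[R]_(bond r' d, n d)),
    exists (C' : tt_cores R n r) (S : forall i, 'M[R]_(bond r i.+1))
           (V : forall i, 'M[R]_(bond r' i.+1, bond r i.+1)),
    let dotA i : tensor3 R (bond r i) (n i) (bond r' i.+1) :=
      fun x => carry S V i *m C i x in
    [/\ A = tt_prod C L,
        forall i, (0 < i < d)%N -> stiefel (lunfold (C i))^T,
        stiefel L^T,
        forall i, (i < d)%N ->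
          trunc_svd (runfold (dotA i)) (runfold (C' i)) (S i) (V i) &
        X = tt_prod C' (carry S V d *m L)]].

(* Main.v *)
Require Import Defs.
From HB Require Import structures.
From mathcomp Require Import all_boot all_order all_algebra.
From mathcomp Require Import ring lra.
From mathcomp Require Import classical_sets reals.

Set Implicit Arguments.
Unset Strict Implicit.
Unset Printing Implicit Defensive.

Import Order.TTheory GRing.Theory Num.Theory.

(** Write Q_k for the product of the first k cores of the output, A_k for the
    same product in the given decomposition of A, and T_k for the factor S V^T
    that the algorithm carries into core k. Each truncated SVD B ~ U S V^T
    satisfies U^T B = S V^T, so by induction T_k = Q_k^T A_k ([carry_tt_left]).
    If the columns of Q_d were orthonormal, X = Q_d T_d L would be the
    orthogonal projection of A = A_d L on the tensors whose last unfolding has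
    its columns in the range of Q_d, and <A - X, X> = 0. They may fail to be
    orthonormal in degenerate cases, but Q_k^T Q_k T_k = T_k always holds
    ([tt_left_gram_carry]) and suffices: with L L^T = 1 both <A, X> and |X|^2
    equal |T_d|^2.

    For the angle condition it remains to compare |T_d| with the norm of a best
    approximation P. For k > 0 the left unfolding of core k of A has
    orthonormal rows, so contracting T_k with this core preserves the norm; a
    matrix with r'_(k+1) columns has at most that many singular values, so
    truncation to r_(k+1) of them keeps at least the fraction r_(k+1) /
    r'_(k+1) of the square norm ([trunc_svd_ratio]). Hence |T_d|^2 is at least
    omega^2 |T_1|^2, where the product starts at bond 2 because the first
    truncation is not charged: it is compared with P directly. Indeed let Pi be
    the orthogonal projector on the column space of the first unfolding of P,
    of rank at most r_1. As the best approximation in a cone, P satisfies |P|^2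
    <= <A, P> = <Pi A, P>, whence |P| <= |Pi A|. The first unfolding of A is
    A_1 times an isometry made of all later factors ([unfolding_tt_prod]), so
    |Pi A| = |Pi A_1|, and this is at most |T_1| because the SVD of A_1 is
    optimal among projectors of rank r_1 ([trunc_svd_best]). *)

Local Open Scope classical_set_scope.
Local Open Scope ring_scope.

(** * The Frobenius inner product *)

Lemma sum_mxvec_index (V : nmodType) (m p : nat) (F : 'I_(m * p) -> V) :
  \sum_k F k = \sum_i \sum_j F (mxvec_index i j).
Proof.
rewrite (reindex (uncurry (@mxvec_index m p))) /=; last exact: curry_mxvec_bij.
by rewrite pair_big; apply: eq_bigr => -[].
Qed.

(** Kept in trace form: adjunction then is associativity or cyclicity of the
    trace. *)
Definition frob (R : comNzRingType) (m p : nat) (M N : 'M[R]_(m, p)) : R :=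
  \tr (M^T *m N).

Lemma frobE (R : comNzRingType) (m p : nat) (M N : 'M[R]_(m, p)) :
  frob M N = \sum_i \sum_j M i j * N i j.
Proof.
rewrite exchange_big; apply: eq_bigr => j _.
by rewrite mxE; apply: eq_bigr => i _; rewrite mxE.
Qed.

Lemma frobC (R : comNzRingType) (m p : nat) (M N : 'M[R]_(m, p)) :
  frob M N = frob N M.
Proof. by rewrite /frob -mxtrace_tr trmx_mul trmxK. Qed.

Lemma frobT (R : comNzRingType) (m p : nat) (M N : 'M[R]_(m, p)) :
  frob M^T N^T = frob M N.
Proof. by rewrite /frob trmxK mxtrace_mulC -mxtrace_tr trmx_mul trmxK. Qed.

Lemma frob_mull (R : comNzRingType) (m k p : nat) (W : 'M[R]_(m, k))
    (M : 'M_(k, p)) (N : 'M_(m, p)) :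
  frob (W *m M) N = frob M (W^T *m N).
Proof. by rewrite /frob trmx_mul mulmxA. Qed.

Lemma frob_mulr (R : comNzRingType) (m k p : nat) (W : 'M[R]_(k, p))
    (M : 'M_(m, k)) (N : 'M_(m, p)) :
  frob (M *m W) N = frob M (N *m W^T).
Proof. by rewrite /frob trmx_mul -mulmxA mxtrace_mulC mulmxA. Qed.

Lemma frob_ge0 (R : realDomainType) (m p : nat) (M : 'M[R]_(m, p)) :
  0 <= frob M M.
Proof.
by rewrite frobE; do 2!apply: sumr_ge0 => ? _; rewrite -expr2 sqr_ge0.
Qed.

Lemma frob_eq0 (R : realDomainType) (m p : nat) (M : 'M[R]_(m, p)) :
  frob M M = 0 -> M = 0.
Proof.
rewrite frobE pair_big => /eqP; rewrite psumr_eq0 => [/allP h|i _]; last first.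
  by rewrite -expr2 sqr_ge0.
apply/matrixP => i j; have := h (i, j); rewrite mem_index_enum => /(_ isT).
by rewrite mulf_eq0 orbb mxE => /eqP.
Qed.

Lemma frob_subr (R : comNzRingType) (m p : nat) (M N : 'M[R]_(m, p)) :
  frob (M - N) (M - N) = frob M M - frob M N *+ 2 + frob N N.
Proof.
have frobBl (K L P : 'M_(m, p)) : frob (K - L) P = frob K P - frob L P.
  by rewrite /frob [(K - L)^T]linearB /= mulmxBl linearB.
by rewrite frobBl !(frobC _ (M - N)) !frobBl (frobC N M); ring.
Qed.

Lemma dot_mxvec (R : realType) (m p : nat) (M N : 'M[R]_(m, p)) :
  dot (mxvec M) (mxvec N) = frob M N.
Proof.
rewrite /dot sum_mxvec_index frobE; apply: eq_bigr => i _.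
by apply: eq_bigr => j _; rewrite !mxvecE.
Qed.

Lemma dot_castmx (R : realType) (k l : nat) (e : k = l) (X Y : 'rV[R]_k) :
  dot (castmx (erefl, e) X) (castmx (erefl, e) Y) = dot X Y.
Proof. by case: l / e; rewrite !castmx_id. Qed.

Lemma dot_ge0 (R : realType) (k : nat) (X : 'rV[R]_k) : 0 <= dot X X.
Proof. by apply: sumr_ge0 => j _; rewrite -expr2 sqr_ge0. Qed.

Lemma enorm_sqr (R : realType) (k : nat) (X : 'rV[R]_k) :
  enorm X ^+ 2 = dot X X.
Proof. by rewrite sqr_sqrtr // dot_ge0. Qed.

(** * Projectors and truncated singular value decompositions *)

(** A weighted sum of nonincreasing terms, with weights in [0, 1] of total mass
    at most s, is largest when the whole mass sits on the s first terms. This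
    one inequality serves twice: with the weights |Pi u_j|^2 it says that a
    truncated SVD captures at least as much as any orthogonal projector Pi of
    rank s, and with constant weights it bounds the loss of norm in one
    truncation. *)
Lemma sum_weighted_le_top (R : realFieldType) (q s : nat) (t w : 'I_q -> R) :
    (forall j, 0 <= t j) ->
    (forall i j : 'I_q, (i <= j)%N -> t j <= t i) ->
    (forall j, 0 <= w j <= 1) -> \sum_j w j <= s%:R ->
  \sum_j t j * w j <= \sum_(j < q | (j < s)%N) t j.
Proof.
move=> t0 tmono w01 ws; rewrite [leRHS]big_mkcond /=.
have [lesq|ltsq] := leqP q s.
  apply: ler_sum => j _; rewrite (leq_trans (ltn_ord j) lesq).
  by case/andP: (w01 j) => _ wj; rewrite -[leRHS]mulr1 ler_wpM2l.
(* Against the pivot value tau, each term favours the indicator of j < s. *)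
pose tau := t (Ordinal ltsq).
have count_top : \sum_(j < q) ((j < s)%N)%:R = s%:R :> R.
  rewrite -natr_sum; congr _%:R.
  by rewrite -big_mkcond /= (big_ord_narrow (ltnW ltsq)) sum1_card card_ord.
rewrite -subr_ge0 -sumrB.
apply: (@le_trans _ _ (\sum_(j < q) tau * (((j < s)%N)%:R - w j))).
  rewrite -mulr_sumr sumrB count_top.
  by apply: mulr_ge0; [exact: t0 | rewrite subr_ge0].
apply: ler_sum => j _; have /andP[wj0 wj1] := w01 j.
case: ltnP => js /=; rewrite ?mulr1n ?mulr0n.
  have : tau <= t j by apply: tmono; apply: ltnW.
  by nra.
have : t j <= tau by apply: tmono.
by nra.
Qed.

(** If v M^T M = 0 then |v M^T|^2 = 0, and M^T is injective on row vectors. *)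
Lemma gram_unitmx (R : realFieldType) (m p : nat) (M : 'M[R]_(m, p)) :
  \rank M = p -> M^T *m M \in unitmx.
Proof.
move=> rM; rewrite -row_free_unit -kermx_eq0; apply/eqP/row_matrixP => i.
rewrite row0; set v := row i _.
have v0 : v *m (M^T *m M) = 0 by rewrite -row_mul mulmx_ker row0.
have vM : v *m M^T = 0.
  by apply: frob_eq0; rewrite frob_mulr trmxK -mulmxA v0 /frob mulmx0 linear0.
have : row_free M^T by rewrite /row_free mxrank_tr rM.
by move=> /row_freeP [W MW]; rewrite -[v]mulmx1 -MW mulmxA vM mul0mx.
Qed.

(** M is the orthogonal sum of M U U^T, which has the norm of M U, and of a
    remainder. *)
Lemma stiefel_frob_le (R : realType) (m p k : nat) (U : 'M[R]_(m, p))
    (M : 'M_(k, m)) :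
  stiefel U -> frob (M *m U) (M *m U) <= frob M M.
Proof.
move=> UU; rewrite -subr_ge0.
suff -> : frob M M - frob (M *m U) (M *m U)
    = frob (M - M *m U *m U^T) (M - M *m U *m U^T) by exact: frob_ge0.
have MUM : frob M (M *m U *m U^T) = frob (M *m U) (M *m U).
  by rewrite frobC frob_mulr trmxK.
have MUU : frob (M *m U *m U^T) (M *m U *m U^T) = frob (M *m U) (M *m U).
  by rewrite frob_mulr trmxK -[_ *m U^T *m U]mulmxA UU mulmx1.
by rewrite frob_subr MUM MUU; ring.
Qed.

Lemma stiefel_col (R : realType) (m p : nat) (U : 'M[R]_(m, p)) (j : 'I_p) :
  stiefel U -> frob (col j U) (col j U) = 1.
Proof.
move=> /(congr1 (fun M : 'M_p => M j j)); rewrite !mxE eqxx mulr1n => <-.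
by rewrite frobE; apply: eq_bigr => i _; rewrite big_ord1 !mxE.
Qed.

(** The usual formula M (M^T M)^-1 M^T, for M a basis of the column space. *)
Lemma col_projector (R : realFieldType) (m p : nat) (P : 'M[R]_(m, p)) :
  exists Pi : 'M_m, [/\ Pi^T = Pi, Pi *m Pi = Pi, Pi *m P = P &
    \tr Pi = (\rank P)%:R].
Proof.
have [M [N [rM eP]]] : exists (M : 'M_(m, \rank P)) (N : 'M_(\rank P, p)),
    \rank M = \rank P /\ P = M *m N.
  exists (col_base P), (row_base P).
  by rewrite mulmx_base; split=> //; apply/eqP/col_base_full.
have uG := gram_unitmx rM.
exists (M *m invmx (M^T *m M) *m M^T).
have MK : M *m invmx (M^T *m M) *m M^T *m M = M.
  by rewrite -!mulmxA mulVmx // mulmx1.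
split.
- by rewrite !trmx_mul trmxK trmx_inv trmx_mul trmxK mulmxA.
- by rewrite !mulmxA MK.
- by rewrite [X in _ *m X = _]eP mulmxA MK -eP.
- by rewrite -mulmxA mxtrace_mulC -mulmxA mulVmx // mxtrace1.
Qed.

Lemma mulmx_colE (R : pzSemiRingType) (m k p : nat) (A : 'M[R]_(m, k))
    (B : 'M_(k, p)) (i : 'I_m) (j : 'I_p) :
  (A *m col j B) i 0 = (A *m B) i j.
Proof. by rewrite !mxE; apply: eq_bigr => l _; rewrite mxE. Qed.

Lemma trace_diag_mul (R : comNzRingType) (q : nat) (d : 'rV[R]_q)
    (M : 'M[R]_q) :
  \tr (diag_mx d *m M) = \sum_j d 0 j * M j j.
Proof.
by apply: eq_bigr => j _; rewrite mul_diag_mx mxE.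
Qed.

Lemma diag_pid_comm (R : comNzRingType) (q s : nat) (sigma : 'rV[R]_q) :
  diag_mx sigma *m (pid_mx s : 'M_q) = (pid_mx s : 'M_q) *m diag_mx sigma.
Proof.
rewrite mul_diag_mx mul_mx_diag; apply/matrixP => i j; rewrite !mxE.
by case: eqVneq => [/val_inj ->|_] /=; [rewrite mulrC | rewrite mulr0 mul0r].
Qed.

Lemma pid_trunc_sq (R : pzSemiRingType) (q s : nat) :
  (pid_mx q : 'M[R]_(q, s)) *m (pid_mx q : 'M_(s, q)) = pid_mx s.
Proof. by rewrite mul_pid_mx minnn minnC pid_mx_minv. Qed.

(** The third equation replaces U^T U = 1, which fails when U has zero columns:
    these columns face zero rows of S. *)
Lemma trunc_svd_eqs (R : realType) (m p s : nat) (B : 'M[R]_(m, p))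
    (U : 'M[R]_(m, s)) (S : 'M[R]_s) (V : 'M[R]_(p, s)) :
  trunc_svd B U S V ->
  [/\ U^T *m B = S *m V^T, B *m V = U *m S & U^T *m U *m S = S].
Proof.
case=> U0 [sigma [V0 [[UU VV _ _ ->] -> -> ->]]].
move: U0 sigma V0 UU VV; set q := minn m p => U0 sigma V0 UU VV.
set J : 'M[R]_(q, s) := pid_mx q; set D := diag_mx sigma.
have tJ : (pid_mx q : 'M_(s, q)) = J^T by rewrite tr_pid_mx.
have DJ : D *m (J *m J^T) = (J *m J^T) *m D.
  by rewrite -tJ pid_trunc_sq diag_pid_comm.
have JJJ : J *m J^T *m J = J.
  by rewrite -tJ pid_trunc_sq mul_pid_mx pid_mx_minv pid_mx_minh.
have JJJt : J^T *m J *m J^T = J^T.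
  by rewrite -[in RHS]JJJ !trmx_mul trmxK mulmxA.
rewrite tJ; split.
- rewrite !trmx_mul !mulmxA -(mulmxA _ U0^T) UU mulmx1; congr (_ *m _).
  by rewrite -!mulmxA DJ !mulmxA JJJt.
- rewrite !mulmxA -(mulmxA _ V0^T) VV mulmx1 -!mulmxA; congr (_ *m _).
  by rewrite !mulmxA -DJ -!mulmxA [J *m _]mulmxA JJJ.
- by rewrite trmx_mul !mulmxA -(mulmxA _ U0^T) UU mulmx1 JJJt.
Qed.

Lemma trunc_svd_frob (R : realType) (m p s : nat) (B : 'M[R]_(m, p))
    (U : 'M[R]_(m, s)) (S : 'M[R]_s) (V : 'M[R]_(p, s)) :
  trunc_svd B U S V ->
  exists U0 sigma V0, thin_svd B U0 sigma V0 /\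
    frob (S *m V^T) (S *m V^T)
      = \sum_(j < minn m p | (j < s)%N) sigma 0 j ^+ 2.
Proof.
move=> h; have [UB _ _] := trunc_svd_eqs h.
case: h => U0 [sigma [V0 [[UU VV s0 smono eB] eU eS eV]]].
exists U0, sigma, V0; split=> //.
rewrite -UB eU eB trmx_mul !mulmxA -(mulmxA _ U0^T) UU mulmx1 tr_pid_mx.
rewrite frob_mulr trmxK -[_ *m V0]mulmxA VV mulmx1 -[X in frob X _]mulmx1.
rewrite -mulmxA frob_mull tr_pid_mx !mulmxA pid_trunc_sq -diag_pid_comm.
rewrite mulmx1 /frob tr_diag_mx.
rewrite trace_diag_mul [RHS]big_mkcond; apply: eq_bigr => j _.
by rewrite mul_diag_mx !mxE eqxx /=; case: ifP => _;
  rewrite ?mulr0 ?mulr1 -?expr2.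
Qed.

Lemma thin_svd_frob (R : realType) (m p k : nat) (B : 'M[R]_(m, p)) U sigma V
    (W : 'M_(k, m)) : thin_svd B U sigma V ->
  frob (W *m B) (W *m B)
    = \sum_j sigma 0 j ^+ 2 * frob (W *m col j U) (W *m col j U).
Proof.
case=> _ VV _ _ ->.
rewrite mulmxA frob_mulr trmxK -[_ *m V]mulmxA VV mulmx1.
rewrite mulmxA frob_mulr tr_diag_mx -[_ *m _ *m diag_mx _]mulmxA mulmx_diag.
rewrite frobE exchange_big; apply: eq_bigr => j _.
rewrite frobE mulr_sumr; apply: eq_bigr => i _.
rewrite big_ord1 mulmx_colE mul_mx_diag [X in _ * X = _]mxE.
by rewrite [(\row__ _) _ _]mxE; ring.
Qed.

(** B has at most p singular values, so the s largest squares have at least the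
    fraction s / p of the total: each square gets the weight s / p. *)
Lemma trunc_svd_ratio (R : realType) (m p s : nat) (B : 'M[R]_(m, p))
    (U : 'M[R]_(m, s)) (S : 'M[R]_s) (V : 'M[R]_(p, s)) :
  (0 < s <= p)%N -> trunc_svd B U S V ->
  s%:R / p%:R * frob B B <= frob (S *m V^T) (S *m V^T).
Proof.
move=> /andP[s_gt0 sp] /trunc_svd_frob[U0 [sigma [V0 [hB ->]]]].
have p_gt0 : 0 < p%:R :> R by rewrite ltr0n (leq_trans s_gt0).
have -> : frob B B = \sum_j sigma 0 j ^+ 2.
  rewrite -[B]mul1mx (thin_svd_frob _ hB); apply: eq_bigr => j _.
  by case: hB => UU _ _ _ _; rewrite mul1mx (stiefel_col _ UU) mulr1.
case: hB => _ _ s0 smono _.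
rewrite mulrC mulr_suml.
apply: (sum_weighted_le_top (t := fun j => sigma 0 j ^+ 2)
   (w := fun=> s%:R / p%:R)).
- by move=> j; rewrite sqr_ge0.
- by move=> i j ij; rewrite lerXn2r ?nnegrE ?s0 ?smono.
- by move=> _; rewrite divr_ge0 ?ler0n //= ler_pdivrMr // mul1r ler_nat.
- rewrite sumr_const card_ord -[_ *+ minn _ _]mulr_natr mulrAC.
  by rewrite ler_pdivrMr // -!natrM ler_nat leq_mul2l geq_minr orbT.
Qed.

(** Eckart and Young, in the form: a projector of rank s captures no more of B
    than its s leading singular directions do. In the basis of left singular
    vectors the square norm of Pi B is the sum of sigma_j^2 |Pi u_j|^2, and
    these weights add up to at most tr Pi. *)
Lemma trunc_svd_best (R : realType) (m p s : nat) (B : 'M[R]_(m, p))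
    (U : 'M[R]_(m, s)) (S : 'M[R]_s) (V : 'M[R]_(p, s)) (Pi : 'M_m) :
    trunc_svd B U S V -> Pi^T = Pi -> Pi *m Pi = Pi -> \tr Pi <= s%:R ->
  frob (Pi *m B) (Pi *m B) <= frob (S *m V^T) (S *m V^T).
Proof.
move=> /trunc_svd_frob[U0 [sigma [V0 [hB ->]]]] tPi PiPi trPi.
rewrite (thin_svd_frob _ hB).
case: hB => UU _ s0 smono _.
apply: (sum_weighted_le_top (t := fun j => sigma 0 j ^+ 2)
   (w := fun j => frob (Pi *m col j U0) (Pi *m col j U0))).
- by move=> j; rewrite sqr_ge0.
- by move=> i j ij; rewrite lerXn2r ?nnegrE ?s0 ?smono.
- move=> j; rewrite frob_ge0 /= -(stiefel_col j UU) -subr_ge0.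
  have -> : frob (col j U0) (col j U0) - frob (Pi *m col j U0) (Pi *m col j U0)
    = frob (col j U0 - Pi *m col j U0) (col j U0 - Pi *m col j U0).
    have PP : frob (Pi *m col j U0) (Pi *m col j U0)
        = frob (col j U0) (Pi *m col j U0).
      by rewrite frob_mull tPi mulmxA PiPi.
    by rewrite frob_subr PP; ring.
  exact: frob_ge0.
- apply: le_trans trPi.
  have -> : \tr Pi = frob Pi Pi by rewrite /frob tPi PiPi.
  apply: le_trans (stiefel_frob_le Pi UU).
  rewrite [leRHS]frobE [leRHS]exchange_big; apply: ler_sum => j _.
  by rewrite frobE; apply: ler_sum => i _; rewrite big_ord1 mulmx_colE.
Qed.

(** * Unfoldings of a core *)

Lemma runfoldE (R : realType) (a m b : nat) (C : tensor3 R a m b) x i j :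
  runfold C (mxvec_index x i) j = C x i j.
Proof. by rewrite !mxE mxvecE mxE. Qed.

Lemma runfoldP (R : realType) (a m b : nat) (C D : tensor3 R a m b) :
  runfold C = runfold D <-> forall x, C x = D x.
Proof.
split=> [e x|e]; first by apply/matrixP => i j; rewrite -!runfoldE e.
apply/matrixP => k j; case/mxvec_indexP: k => x i.
by rewrite !runfoldE e.
Qed.

Lemma runfold_mulr (R : realType) (a m b c : nat) (C : tensor3 R a m b)
    (Z : 'M_(b, c)) :
  runfold (fun x => C x *m Z) = runfold C *m Z.
Proof.
apply/matrixP => k j; case/mxvec_indexP: k => x i.
by rewrite runfoldE !mxE; apply: eq_bigr => l _; rewrite runfoldE.
Qed.

Lemma runfold_gram (R : realType) (a m b c : nat) (C : tensor3 R a m b)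
    (D : tensor3 R a m c) :
  (runfold C)^T *m runfold D = \sum_x (C x)^T *m D x.
Proof.
apply/matrixP => j k; rewrite mxE sum_mxvec_index summxE.
apply: eq_bigr => x _; rewrite mxE; apply: eq_bigr => i _.
by rewrite !(mxE, runfoldE) mxvecE mxE.
Qed.

Lemma lunfold_gram (R : realType) (a m b : nat) (C : tensor3 R a m b) :
  lunfold C *m (lunfold C)^T = \sum_x C x *m (C x)^T.
Proof.
apply/matrixP => i k; rewrite mxE sum_mxvec_index exchange_big summxE.
apply: eq_bigr => x _; rewrite mxE; apply: eq_bigr => j _.
by rewrite !mxE !mxvecE !mxE.
Qed.

(** Merging the mode of C with its right bond instead of its left one turns the
    contraction into M times the left unfolding of C, whose rows are
    orthonormal, without changing the norm. *)
Lemma frob_runfold_stiefel (R : realType) (a m b c : nat) (C : tensor3 R a m b)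
    (M : 'M_(c, a)) : stiefel (lunfold C)^T ->
  frob (runfold (fun x => M *m C x)) (runfold (fun x => M *m C x)) = frob M M.
Proof.
rewrite /stiefel trmxK lunfold_gram => CC.
rewrite -[RHS]/(\tr (M^T *m M)) -[M^T *m M]mulmx1 -CC mulmx_sumr linear_sum.
rewrite /frob runfold_gram linear_sum; apply: eq_bigr => x _ /=.
by rewrite trmx_mul -!mulmxA mxtrace_mulC -!mulmxA.
Qed.

(** * The sweep of truncations *)

Definition svd_sweep (R : realType) (n r r' : nat -> nat) (d : nat)
    (C : tt_cores R n r') (C' : tt_cores R n r)
    (S : forall i, 'M[R]_(bond r i.+1))
    (V : forall i, 'M[R]_(bond r' i.+1, bond r i.+1)) : Prop :=
  forall i, (i < d)%N ->
    trunc_svd (runfold (fun x => carry S V i *m C i x)) (runfold (C' i))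
      (S i) (V i).

(** The carried factor is the matrix of coordinates of the exact left part of A
    along the columns computed so far; hence the rounded tensor is Q Q^T
    applied to A, for Q the left part of the output. This follows from U^T B =
    S V^T at each truncation. *)
Lemma carry_tt_left (R : realType) (n r r' : nat -> nat) (d : nat)
    (C : tt_cores R n r') (C' : tt_cores R n r)
    (S : forall i, 'M[R]_(bond r i.+1))
    (V : forall i, 'M[R]_(bond r' i.+1, bond r i.+1)) (k : nat) :
  svd_sweep d C C' S V -> (k <= d)%N ->
  carry S V k = (tt_left C' k)^T *m tt_left C k.
Proof.
move=> hsvd; elim: k => [_|k IHk kd]; first by rewrite /= trmx1 mulmx1.
have [UB _ _] := trunc_svd_eqs (hsvd _ kd).
rewrite /= -UB !runfold_gram; apply: eq_bigr => x _.
by rewrite IHk ?(ltnW kd) // trmx_mul !mulmxA.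
Qed.

(** Here tt_left C' k need not have orthonormal columns: the padding of the SVD
    creates zero columns in a core, and a singular vector for the singular
    value 0 is arbitrary, so that in the next core it may have components along
    them. The defect is invisible from the carried factor, because U S = B V
    has its columns in the range of the preceding carried factor. *)
Lemma tt_left_gram_carry (R : realType) (n r r' : nat -> nat) (d : nat)
    (C : tt_cores R n r') (C' : tt_cores R n r)
    (S : forall i, 'M[R]_(bond r i.+1))
    (V : forall i, 'M[R]_(bond r' i.+1, bond r i.+1)) (k : nat) :
  svd_sweep d C C' S V -> (k <= d)%N ->
  (tt_left C' k)^T *m tt_left C' k *m carry S V k = carry S V k.
Proof.
move=> hsvd; elim: k => [_|k IHk kd]; first by rewrite /= trmx1 !mulmx1.
have [_ BV US] := trunc_svd_eqs (hsvd _ kd).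
rewrite /= mulmxA; congr (_ *m _); rewrite -[RHS]US !runfold_gram.
have CS x : C' k x *m S k = carry S V k *m C k x *m V k.
  by move: x; apply/runfoldP; rewrite !runfold_mulr BV.
rewrite !mulmx_suml; apply: eq_bigr => x _.
rewrite trmx_mul -!mulmxA !CS.
by rewrite -[in RHS]IHk ?(ltnW kd) // !mulmxA.
Qed.

(** Contraction with the next core preserves the norm, which therefore drops
    only in the truncation. *)
Lemma carry_frob_step (R : realType) (n r r' : nat -> nat) (d : nat)
    (C : tt_cores R n r') (C' : tt_cores R n r)
    (S : forall i, 'M[R]_(bond r i.+1))
    (V : forall i, 'M[R]_(bond r' i.+1, bond r i.+1)) (k : nat) :
  svd_sweep d C C' S V -> (0 < k < d)%N -> (0 < r k.+1 <= r' k.+1)%N ->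
    stiefel (lunfold (C k))^T ->
  (r k.+1)%:R / (r' k.+1)%:R * frob (carry S V k) (carry S V k)
    <= frob (carry S V k.+1) (carry S V k.+1).
Proof.
move=> hsvd /andP[k0 kd] hr hC.
rewrite -(frob_runfold_stiefel _ hC).
exact: trunc_svd_ratio hr (hsvd _ kd).
Qed.

Lemma carry_frob_ge (R : realType) (n r r' : nat -> nat) (d : nat)
    (C : tt_cores R n r') (C' : tt_cores R n r)
    (S : forall i, 'M[R]_(bond r i.+1))
    (V : forall i, 'M[R]_(bond r' i.+1, bond r i.+1)) (k : nat) :
  svd_sweep d C C' S V -> (k < d)%N ->
    (forall i, (0 < i <= d)%N -> (0 < r i <= r' i)%N) ->
    (forall i, (0 < i < d)%N -> stiefel (lunfold (C i))^T) ->
  (\prod_(2 <= i < k.+2) r i)%:R / (\prod_(2 <= i < k.+2) r' i)%:R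
     * frob (carry S V 1) (carry S V 1)
    <= frob (carry S V k.+1) (carry S V k.+1).
Proof.
move=> hsvd + hr hC; elim: k => [_|k IHk kd].
  by rewrite !big_geq // divr1 mul1r.
apply: le_trans (carry_frob_step hsvd _ _ _);
  [|by []|exact: hr|exact: hC].
rewrite [in X in X / _](@big_nat_recr _ _ _ k.+2) //.
rewrite [in X in _ / X](@big_nat_recr _ _ _ k.+2) //=.
rewrite !natrM invfM mulrACA [X in X * _ <= _]mulrC -[leLHS]mulrA.
by apply: ler_wpM2l; rewrite ?divr_ge0 ?ler0n // IHk // ltnW.
Qed.

(** * Unfoldings of a tensor train *)

Lemma unfoldingE (R : realType) (n : nat -> nat) (D : nat)
    (X : tensor R n D) (i : 'I_D) (a : 'I_(numel n i))
    (c : 'I_(\prod_(i <= j < D) n j)) (q : 'I_(numel n D)) :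
  q = (c * numel n i + a)%N :> nat -> unfolding X i a c = X 0 q.
Proof.
move=> qE; rewrite !mxE castmxE; congr (X _ _); first exact: ord1.
apply: val_inj; rewrite [RHS]qE; exact: mxvec_index_val.
Qed.

Lemma unfoldingZ (R : realType) (n : nat -> nat) (D : nat) (t : R)
    (X : tensor R n D) (i : 'I_D) :
  unfolding (t *: X : tensor R n D) i = t *: unfolding X i.
Proof. by apply/matrixP => a c; rewrite !(mxE, castmxE). Qed.

Lemma dot_unfolding (R : realType) (n : nat -> nat) (D : nat)
    (X Y : tensor R n D) (i : 'I_D) :
  dot X Y = frob (unfolding X i) (unfolding Y i).
Proof. by rewrite frobT -dot_mxvec !vec_mxK dot_castmx. Qed.

Lemma dot_tt_prod (R : realType) (n r r' : nat -> nat) (d : nat)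
    (C : tt_cores R n r') (C' : tt_cores R n r) (L : 'M_(bond r' d, n d)) L' :
  dot (tt_prod C L) (tt_prod C' L')
    = frob (tt_left C d *m L) (tt_left C' d *m L').
Proof. by rewrite dot_mxvec frobT. Qed.

Lemma radix_inj (M x y p q : nat) : (p < M)%N -> (q < M)%N ->
  (x * M + p = y * M + q)%N -> x = y /\ p = q.
Proof.
move=> pM qM e; have M0 : (0 < M)%N by apply: leq_ltn_trans pM.
split; [move: (congr1 (divn^~ M) e)|move: (congr1 (modn^~ M) e)].
  by rewrite !divnMDl // !divn_small // !addn0.
by rewrite !modnMDl !modn_small.
Qed.

(** A core or a product of cores is seen as a family of matrices indexed by its
    merged modes; slice_cat appends one mode, which becomes the slowest index
    as it does in numel. *)
Definition slice_cat (R : realType) (a b c m w : nat) (G : 'I_w -> 'M[R]_(a, b))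
    (K : 'I_m -> 'M[R]_(b, c)) : 'I_(m * w) -> 'M[R]_(a, c) :=
  fun k => mxvec (\matrix_(x < m, y < w) (G y *m K x)) 0 k.

Lemma slice_catE (R : realType) (a b c m w : nat) (G : 'I_w -> 'M[R]_(a, b))
    (K : 'I_m -> 'M[R]_(b, c)) x y :
  slice_cat G K (mxvec_index x y) = G y *m K x.
Proof. by rewrite /slice_cat mxvecE mxE. Qed.

Lemma slice_cat_gram (R : realType) (a b c m w : nat)
    (G : 'I_w -> 'M[R]_(a, b)) (K : 'I_m -> 'M[R]_(b, c)) :
    \sum_y G y *m (G y)^T = 1%:M -> \sum_x K x *m (K x)^T = 1%:M ->
  \sum_k slice_cat G K k *m (slice_cat G K k)^T = 1%:M.
Proof.
move=> GG KK; rewrite sum_mxvec_index exchange_big /= -[RHS]GG.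
apply: eq_bigr => y _.
rewrite -[X in _ = X *m _]mulmx1 -KK mulmx_sumr mulmx_suml.
by apply: eq_bigr => x _; rewrite slice_catE trmx_mul !mulmxA.
Qed.

(** The contraction of the cores i, ..., i + e - 1. The bond is written e + i
    so that adding a core changes it by a successor, without a cast. *)
Fixpoint tt_mid (R : realType) (n r : nat -> nat) (C : tt_cores R n r)
    (i e : nat) : 'I_(numel (fun j => n (j + i)%N) e) ->
                  'M[R]_(bond r i, bond r (e + i)) :=
  if e is e'.+1 then slice_cat (@tt_mid R n r C i e') (C (e' + i)%N)
  else fun=> 1%:M.

Lemma numel_add (n : nat -> nat) (i e : nat) :
  numel n (e + i) = (numel (fun j => n (j + i)%N) e * numel n i)%N.
Proof. by elim: e => [|e IHe] /=; rewrite ?mul1n // IHe mulnA. Qed.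

Lemma numel_shift (n : nat -> nat) (i e : nat) :
  numel (fun j => n (j + i)%N) e = (\prod_(i <= j < e + i) n j)%N.
Proof.
elim: e => [|e IHe] /=; first by rewrite big_geq.
by rewrite addSn big_nat_recr ?leq_addl //= IHe mulnC.
Qed.

Lemma tt_left_mid (R : realType) (n r : nat -> nat) (C : tt_cores R n r)
    (i e : nat) (p : 'I_(numel n (e + i))) (a : 'I_(numel n i))
    (c : 'I_(numel (fun j => n (j + i)%N) e)) :
  p = (c * numel n i + a)%N :> nat ->
  row p (tt_left C (e + i)) = row a (tt_left C i) *m @tt_mid R n r C i e c.
Proof.
elim: e p c => [|e IHe] p c.
  rewrite [c]ord1 mulmx1 => pa; congr (row _ _); exact: val_inj.
suff step (x y : 'I_(n (e + i)%N)) (q : 'I_(numel n (e + i)))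
    (b : 'I_(numel (fun j => n (j + i)%N) e)) :
    (x * numel n (e + i) + q
       = (y * numel (fun j => n (j + i)%N) e + b) * numel n i + a)%N ->
    row (mxvec_index x q) (tt_left C (e + i).+1)
      = row a (tt_left C i) *m @tt_mid R n r C i e.+1 (mxvec_index y b).
  case/mxvec_indexP: p => x q; case/mxvec_indexP: c => y b.
  by rewrite !mxvec_index_val; exact: step.
rewrite [X in (x * X + _)%N]numel_add mulnDl -mulnA -addnA.
have qM : (q < numel (fun j => n (j + i)%N) e * numel n i)%N.
  by rewrite -numel_add.
have bM : (b * numel n i + a < numel (fun j => n (j + i)%N) e * numel n i)%N.
  apply: (@leq_trans (b.+1 * numel n i)); first by rewrite mulSnr ltn_add2l.
  by rewrite leq_mul2r ltn_ord orbT.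
move=> /(radix_inj qM bM)[/val_inj -> /IHe rowq].
have -> : row (mxvec_index y q) (tt_left C (e + i).+1)
    = row q (tt_left C (e + i)) *m C (e + i)%N y.
  rewrite -row_mul; apply/rowP => j; rewrite [LHS]mxE [RHS]mxE.
  exact: runfoldE.
by rewrite rowq /= slice_catE mulmxA.
Qed.

Lemma tt_mid_gram (R : realType) (n r : nat -> nat) (C : tt_cores R n r)
    (i e : nat) :
  (forall k, (i <= k < e + i)%N -> stiefel (lunfold (C k))^T) ->
  \sum_c @tt_mid R n r C i e c *m (@tt_mid R n r C i e c)^T = 1%:M.
Proof.
elim: e => [|e IHe] hC; first by rewrite big_ord1 trmx1 mulmx1.
apply: slice_cat_gram.
  by apply: IHe => k /andP[ik ke]; apply: hC; rewrite ik ltnS ltnW.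
have := hC (e + i)%N; rewrite leq_addl leqnn => /(_ isT).
by rewrite /stiefel trmxK lunfold_gram.
Qed.

(** Both uses of the factor structure are here: the first i cores give the
    column space of the i-th unfolding, hence the rank bound, and the remaining
    cores, when the rows of their left unfoldings are orthonormal, act on row
    vectors as an isometry G. *)
Lemma unfolding_tt_prod (R : realType) (n r : nat -> nat) (d : nat)
    (C : tt_cores R n r) (L : 'M[R]_(bond r d, n d)) (i : 'I_d.+1) :
  exists G : 'M[R]_(bond r i, \prod_(i <= j < d.+1) n j),
    unfolding (tt_prod C L) i = tt_left C i *m G /\
    ((forall k, (i <= k < d)%N -> stiefel (lunfold (C k))^T) -> stiefel L^T ->
     G *m G^T = 1%:M).
Proof.
case: i => i /= lti; have dE : d = (d - i + i)%N by rewrite subnK.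
move: (d - i)%N dE => e dE; subst d.
(* L acts as one more core, whose right bond has size 1. *)
pose T := slice_cat (@tt_mid R n r C i e) (fun y => col y L).
exists (\matrix_(b, c) T (cast_ord (esym (numel_shift n i e.+1)) c) b 0).
split.
  apply/matrixP => a c0.
  have [c ->] : exists c, c0 = cast_ord (numel_shift n i e.+1) c.
    by exists (cast_ord (esym (numel_shift n i e.+1)) c0); apply: val_inj.
  case/mxvec_indexP: c => y c.
  have pP : (c * numel n i + a < numel n (e + i))%N.
    rewrite numel_add.
    apply: (@leq_trans (c.+1 * numel n i)); first by rewrite mulSnr ltn_add2l.
    by rewrite leq_mul2r ltn_ord orbT.
  pose k : 'I_(numel n (e + i).+1) := mxvec_index y (Ordinal pP).
  transitivity ((tt_prod C L : 'rV_(numel n (e + i).+1)) 0 k).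
    have cE : cast_ord (numel_shift n i e.+1) (mxvec_index y c)
        = (y * numel (fun j => n (j + i)%N) e + c)%N :> nat.
      exact: mxvec_index_val.
    apply: unfoldingE; rewrite cE [LHS](mxvec_index_val y (Ordinal pP)).
    by rewrite [X in (y * X + _)%N]numel_add mulnDl mulnA addnA.
  rewrite /tt_prod mxvecE mxE.
  have rowp := @tt_left_mid _ _ _ C i e (Ordinal pP) a c erefl.
  transitivity ((row (Ordinal pP) (tt_left C (e + i)) *m L) 0 y).
    by rewrite -row_mul [RHS]mxE.
  rewrite rowp -mulmxA -row_mul [LHS]mxE [LHS]mxE [RHS]mxE.
  apply: eq_bigr => b _; congr (_ * _).
  by rewrite [RHS]mxE cast_ordK /T slice_catE mulmx_colE.
move=> hC hL; have TT : \sum_k T k *m (T k)^T = 1%:M.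
  apply: slice_cat_gram; first exact: tt_mid_gram.
  rewrite -[RHS]hL trmxK; apply/matrixP => b b'.
  rewrite summxE mxE; apply: eq_bigr => y _.
  by rewrite mxE big_ord1 !mxE.
rewrite -TT; apply/matrixP => b b'; rewrite mxE summxE.
rewrite (reindex (cast_ord (numel_shift n i e.+1))) /=; last first.
  exists (cast_ord (esym (numel_shift n i e.+1))) => ? _.
    by rewrite cast_ordK.
  by rewrite cast_ordKV.
by apply: eq_bigr => k _; rewrite [RHS]mxE big_ord1 !mxE !cast_ordK.
Qed.

(** * Best approximations *)

(** Tensors of bounded rank form a cone, so P is also a best approximation
    among its own multiples t P; the value t = <A, P> / <P, P> gives the claim.
    *)
Lemma tt_proj_dot_le (R : realType) (n : nat -> nat) (D : nat) (k : nat -> nat)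
    (A P : tensor R n D) : tt_proj k A P -> dot P P <= dot A P.
Proof.
case=> Pk Pmin.
have dist (t : R) : dot (A - t *: P) (A - t *: P)
    = dot A A - dot A P * t *+ 2 + t ^+ 2 * dot P P.
  rewrite /dot mulr_suml -sumrMnl mulr_sumr -sumrB -big_split /=.
  by apply: eq_bigr => j _; rewrite !mxE; ring.
have Pt (t : R) : - dot A P *+ 2 + dot P P
    <= - dot A P * t *+ 2 + t ^+ 2 * dot P P.
  have /Pmin : tt_le k (t *: P : tensor R n D).
    move=> i i0; rewrite unfoldingZ.
    exact: leq_trans (mxrank_scale _ _) (Pk i i0).
  rewrite !enorm_sqr dist -[P in X in X <= _]scale1r dist; lra.
have [P0|Pn0] := eqVneq (dot P P) 0.
  have := Pt 0; rewrite P0; lra.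
have Pp : 0 < dot P P by rewrite lt_neqAle eq_sym Pn0 dot_ge0.
have := Pt (dot A P / dot P P).
set a := dot A P; set p := dot P P in Pn0 Pp *.
have -> : - a * (a / p) *+ 2 + (a / p) ^+ 2 * p = - (a ^+ 2 / p) by field.
rewrite -subr_ge0 -(pmulr_rge0 _ Pp).
have -> : p * (- (a ^+ 2 / p) - (- a *+ 2 + p)) = - (a - p) ^+ 2 by field.
rewrite oppr_ge0 => h; have : (a - p) ^+ 2 = 0.
  by apply/eqP; rewrite eq_le h sqr_ge0.
by move=> /eqP; rewrite sqrf_eq0 subr_eq0 => /eqP ->.
Qed.

(** * Quasi-optimality of the rounding *)

Theorem theorem3p5 (R : realType) (d : nat) (n r r' : nat -> nat)
    (A : tensor R n d.+1) (hd : (0 < d)%N)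
    (hr : forall i, (0 < i <= d)%N -> (0 < r i <= r' i)%N)
    (hA : tt_le r' A) :
  tt_rounding r' r A `<=` tt_le r /\
  forall X : tensor R n d.+1, tt_rounding r' r A X ->
    [/\ dot (A - X) X = 0,
        dot A X = enorm X ^+ 2 &
        forall P : tensor R n d.+1, tt_proj r A P ->
          Num.sqrt ((\prod_(2 <= i < d.+1) r i)%:R
                    / (\prod_(2 <= i < d.+1) r' i)%:R) * enorm P
          <= enorm X].
Proof.
split=> [X [C [L [C' [S [V [_ _ _ _ ->]]]]]] [i lti] i0|X].
  have [G [-> _]] := unfolding_tt_prod C' (carry S V d *m L) (Ordinal lti).
  apply: leq_trans (mxrankM_maxl _ _) _; apply: leq_trans (rank_leq_col _) _.
  by case: i lti i0 G.
case=> C [L [C' [S [V [eA hC hL hsvd eX]]]]].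
have LL : L *m L^T = 1%:M by rewrite -[RHS]hL trmxK.
have carryA := carry_tt_left hsvd (leqnn d).
have carryX := tt_left_gram_carry hsvd (leqnn d).
have dotXX : dot X X = frob (carry S V d) (carry S V d).
  rewrite eX dot_tt_prod mulmxA frob_mulr -[_ *m L *m L^T]mulmxA LL mulmx1.
  by rewrite frob_mull mulmxA carryX.
have dotAX : dot A X = dot X X.
  rewrite dotXX eA eX dot_tt_prod mulmxA frob_mulr.
  by rewrite -[_ *m L *m L^T]mulmxA LL mulmx1 frobC frob_mull -carryA.
split; first 1 last.
- by rewrite enorm_sqr.
- move=> P hP.
  have l1 : (1 < d.+1)%N by [].
  pose i1 : 'I_d.+1 := Ordinal l1.
  have [Pi [tPi PiPi PiP trPi]] := col_projector (unfolding P i1).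
  have rP : \tr Pi <= (r 1%N)%:R.
    by rewrite trPi ler_nat; case: hP => /(_ i1 isT).
  have [G [AG GG]] := unfolding_tt_prod C L i1.
  have {}GG : G *m G^T = 1%:M by exact: GG.
  (* |P|^2 <= <Pi A, P> and 0 <= |Pi A - P|^2 give |P|^2 <= |Pi A|^2. *)
  have PP : dot P P <= frob (carry S V 1) (carry S V 1).
    have := tt_proj_dot_le hP; rewrite !(dot_unfolding _ _ i1).
    rewrite -[X in frob (unfolding A i1) X]PiP -tPi -frob_mull eA AG mulmxA.
    have nA : frob (Pi *m tt_left C 1 *m G) (Pi *m tt_left C 1 *m G)
        <= frob (carry S V 1) (carry S V 1).
      rewrite frob_mulr -[_ *m G *m G^T]mulmxA GG mulmx1.
      exact: (trunc_svd_best (hsvd 0%N hd) tPi PiPi rP).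
    have := frob_ge0 (Pi *m tt_left C 1 *m G - unfolding P i1).
    rewrite frob_subr => ? ?; lra.
  have := carry_frob_ge hsvd (k := d.-1).
  rewrite prednK // => /(_ (leqnn _) hr hC).
  rewrite -dotXX => XX.
  rewrite /enorm -sqrtrM ?divr_ge0 ?ler0n // ler_wsqrtr //.
  apply: le_trans XX; apply: ler_wpM2l PP.
  by rewrite divr_ge0 ?ler0n.
have -> : dot (A - X) X = dot A X - dot X X.
  by rewrite /dot -sumrB; apply: eq_bigr => j _; rewrite !mxE mulrBl.
by rewrite dotAX subrr.
Qed.
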